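(* Let $(S,T)$ be a pair of standard Young tableaux of the same shape, and let $(S',T')$ be the result of applying the RSK algorithm to the reading word of $T$. Then $(S',T')$ have the same shape as $(S,T)$.
   Context: A permutation of $1,2,\ldots,n$ is written as a word $\pi=\pi_1,\ldots,\pi_n$. A Young diagram of a partition $\lambda=(\lambda_1\ge\cdots\ge\lambda_k>0)$ of $n$ is drawn in French notation: left-justified rows, with $\lambda_i$ boxes in the $i$-th row from the bottom. A standard Young tableau (SYT) of shape $\lambda$ is a filling of the boxes with $1,\ldots,n$, each used once, with rows increasing left to right and columns increasing bottom to top. RSK: for a permutation $\pi$, $\mathrm{RSK}(\pi)=(S,T)$, where $S$ (the insertion tableau) is obtained by starting from the empty tableau and inserting $\pi_1,\pi_2,\ldots,\pi_n$ in order. To insert $a$ into a row (starting with the bottom row): if $a$ is larger than every entry of the row, place $a$ at the end of the row and stop; otherwise $a$ replaces the leftmost entry $b$ of the row that is greater than $a$, and $b$ is then inserted into the next row up by the same rule. The recording tableau $T$ has the same shape as $S$, with the box that is newly created when inserting $\pi_i$ labeled $i$. RSK is a bijection from permutations of size $n$ to pairs of SYT of size $n$ of the same shape. The reading word of an SYT is the permutation obtained by concatenating its rows from the top row to the bottom row, each read left to right. *)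

(* Defs.v *)
From mathcomp Require Import all_boot.

Set Implicit Arguments.
Unset Strict Implicit.
Unset Printing Implicit Defensive.

(* French notation: the list of rows, from bottom to top; each row is read from
   left to right.  A permutation of 1, ..., n is a word in [seq nat]. *)
Definition tableau := seq (seq nat).

Definition is_partition (la : seq nat) : bool := sorted geq la && (0 \notin la).

(* The rows reaching past j have an entry in column j. *)
Definition column (t : tableau) (j : nat) : seq nat :=
  [seq nth 0 r j | r <- t & j < size r].

Definition is_syt (t : tableau) : bool :=
  [&& is_partition (shape t),
      all (sorted ltn) t,
      all (fun j => sorted ltn (column t j)) (iota 0 (size (head [::] t)))
    & perm_eq (flatten t) (iota 1 (size (flatten t)))].

Definition reading_word (t : tableau) : seq nat := flatten (rev t).

(* Returns the new tableau and the index (from 0, at the bottom) of the row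
   whose end carries the newly created box.  Meaningful when [a] and the
   entries of [t] are distinct, as for the letters of a permutation. *)
Fixpoint insert (t : tableau) (a : nat) : tableau * nat :=
  if t is r :: t' then
    if all (fun b => b < a) r then (rcons r a :: t', 0)
    else
      let i := find (fun b => a < b) r in
      let: (t'', k) := insert t' (nth 0 r i) in
      (set_nth 0 r i a :: t'', k.+1)
  else ([:: [:: a]], 0).

(* [set_nth] appends a new row on top when [k = size t]. *)
Definition add_box (t : tableau) (k i : nat) : tableau :=
  set_nth [::] t k (rcons (nth [::] t k) i).

Definition rsk_step (st : tableau * tableau) (ai : nat * nat) :
    tableau * tableau :=
  let: (s, k) := insert st.1 ai.1 in (s, add_box st.2 k ai.2).

Definition rsk (w : seq nat) : tableau * tableau :=
  foldl rsk_step ([::], [::]) (zip w (iota 1 (size w))).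

(* Main.v *)
Require Import Defs.
From mathcomp Require Import all_boot.

(** Insert the rows of [T] from top to bottom.  When a row [r] is inserted into
    the tableau [t] formed by the rows above it, its [j]-th letter is smaller
    than the [j]-th letter of the bottom row of [t] and larger than the letters
    of [r] already placed, so it bumps exactly the [j]-th letter (or is appended
    once that row is exhausted).  Hence [r] replaces the bottom row, which is
    itself inserted, letter by letter, one row higher.  Every row thus moves up
    by one, and the insertion tableau of the reading word of [T] is [T]. *)

Definition insert_word (t : tableau) (w : seq nat) : tableau :=
  foldl (fun t a => (insert t a).1) t w.

Lemma insert_word_cat (t : tableau) (v w : seq nat) :
  insert_word t (v ++ w) = insert_word (insert_word t v) w.
Proof. exact: foldl_cat. Qed.

Lemma shape_add_box (t : tableau) (k i : nat) :
  shape (add_box t k i) = incr_nth (shape t) k.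
Proof.
rewrite /add_box; elim: t k => [|r t IHt] [|k] //=.
(* Past the top row, [set_nth] pads with empty rows just as [incr_nth] pads with zeros. *)
- by congr cons; elim: k => //= k ->.
- by rewrite size_rcons.
- by rewrite IHt.
Qed.

Lemma perm_set_nth (T : eqType) (x0 y : T) (s : seq T) (i : nat) :
  i < size s -> perm_eq (nth x0 s i :: set_nth x0 s i y) (y :: s).
Proof.
move=> lt_i_s; rewrite set_nthE lt_i_s.
rewrite -[in X in perm_eq _ X](cat_take_drop i s) (drop_nth x0 lt_i_s).
apply/permP => p; rewrite /= !count_cat /= addnCA [RHS]addnCA.
by congr addn; rewrite addnCA.
Qed.

Lemma find_gt_size (r : seq nat) (a : nat) :
  a \notin r -> ~~ all (fun b => b < a) r -> find (fun b => a < b) r < size r.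
Proof.
move=> a_r /allPn[b b_r]; rewrite -leqNgt leq_eqVlt => /orP[/eqP eq_ab|lt_ab].
  by rewrite eq_ab b_r in a_r.
by rewrite -has_find; apply/hasP; exists b.
Qed.

(* If [a] occurred in [t], [find] could run past the end of a row, and
   [set_nth] would then lengthen it: hence the hypothesis. *)
Lemma insert_uniq (t : tableau) (a : nat) : uniq (a :: flatten t) ->
  shape (insert t a).1 = incr_nth (shape t) (insert t a).2 /\
  perm_eq (flatten (insert t a).1) (a :: flatten t).
Proof.
elim: t a => [|r t IHt] a //= /andP[]; rewrite mem_cat negb_or => /andP[a_r a_t].
case: ifP => [_ _|/negbT not_lt uniq_rt] /=.
  by rewrite size_rcons cat_rcons (perm_catCA r [:: a]).
have lt_i := find_gt_size _ _ a_r not_lt; set i := find _ r in lt_i *.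
(* The bumped letter comes from [r], so uniqueness keeps it out of the rows above. *)
have uniq_bt : uniq (nth 0 r i :: flatten t).
  move: uniq_rt; rewrite cat_uniq /= => /and3P[_ /hasPn dis ->]; rewrite andbT.
  by apply/negP => /dis; rewrite /= mem_nth.
case: insert (IHt _ uniq_bt) => t' k /= [-> perm_t']; split.
  by rewrite size_set_nth (maxn_idPr lt_i).
rewrite (permPl (perm_cat (perm_refl _) perm_t')).
rewrite (perm_catCA _ [:: _]) catA -cat_cons perm_cat //.
exact: perm_set_nth.
Qed.

Lemma rsk_insert_word (w : seq nat) : (rsk w).1 = insert_word [::] w.
Proof.
suff gen : forall i st, (foldl rsk_step st (zip w (iota i (size w)))).1
    = insert_word st.1 w by exact: gen.
elim: w => [|a w IHw] i [s t] //=.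
by rewrite IHw /rsk_step /=; case: insert.
Qed.

(** Each step adds a box to both tableaux in the row returned by [insert], so equal shapes stay
    equal. *)
Lemma shape_rsk (w : seq nat) :
  uniq w -> shape (rsk w).2 = shape (rsk w).1.
Proof.
rewrite /rsk => uniq_w.
(* Uniqueness of the pending letters together with the entries of [s] keeps [insert_uniq] applicable
   at every step. *)
suff gen : forall i (s t : tableau), shape t = shape s -> uniq (w ++ flatten s) ->
    let st := foldl rsk_step (s, t) (zip w (iota i (size w))) in
    shape st.2 = shape st.1.
  by apply: gen; rewrite ?cats0.
elim: {uniq_w} w => [|a w IHw] i s t //= eq_st /andP[a_ws uniq_ws].
have uniq_as : uniq (a :: flatten s).
  move: a_ws uniq_ws; rewrite mem_cat negb_or cat_uniq /=.
  by move=> /andP[_ ->] /and3P[].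
rewrite {2 4}/rsk_step /=.
case: insert (insert_uniq _ _ uniq_as) => s' k /= [sh_s' perm_s'].
apply: IHw; first by rewrite shape_add_box eq_st sh_s'.
rewrite (perm_uniq (perm_cat (perm_refl w) perm_s')) -cat1s uniq_catCA /=.
by rewrite a_ws.
Qed.

(** Column strictness for a lower row [w] and the row [v] just above it; given the size condition,
    [zip] stops at the end of [v]. *)
Definition dominated (w v : seq nat) : bool :=
  (size v <= size w) && all (fun p => p.1 < p.2) (zip w v).

(** In the induction on [w], [u] holds the letters already placed and [v] those still to be
    bumped. *)
Lemma insert_word_row (u v w : seq nat) (t : tableau) :
  sorted ltn (u ++ w) -> dominated w v ->
  insert_word ((u ++ v) :: t) w = (u ++ w) :: insert_word t v.
Proof.
elim: w u v t => [|a w IHw] u v t sorted_uaw; first by case: v.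
have lt_ua : all (fun b => b < a) u.
  move: sorted_uaw; rewrite (sorted_pairwise ltn_trans) pairwise_cat.
  by move=> /andP[/allrelP lt_u _]; apply/allP => c /lt_u-> //; rewrite mem_head.
case: v => [_|b v].
  (* The old row is exhausted: the letter is appended, and [v] stays empty from here on. *)
  rewrite /insert_word /= cats0 lt_ua /= -cat_rcons -[rcons u a]cats0.
  by rewrite -!/(insert_word _ _) IHw ?cats0 ?cat_rcons // /dominated; case: (w).
rewrite /dominated /= ltnS => /and3P[le_vw lt_ab lt_wv].
have find_u : find (fun c => a < c) (u ++ b :: v) = size u.
  rewrite find_cat /= lt_ab addn0; case: hasP => // -[c /(allP lt_ua)].
  by rewrite ltnNge => /negP le_ac /ltnW.
rewrite /insert_word /= all_cat /= ltnNge (ltnW lt_ab) andbF find_u.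
rewrite nth_cat ltnn subnn /=; case: insert => t' k /=.
(* Overwriting position [size u] turns [u ++ b :: v] into [rcons u a ++ v], the form needed by the
   induction hypothesis. *)
rewrite set_nthE size_cat /= -addSnnS leq_addr take_size_cat //.
rewrite -(cat_rcons b) drop_size_cat ?size_rcons // -(cat_rcons a).
by rewrite -/(insert_word _ _) IHw ?cat_rcons // /dominated le_vw.
Qed.

Lemma insert_word_nil (w : seq nat) :
  sorted ltn w -> w != [::] -> insert_word [::] w = [:: w].
Proof.
case: w => // a w sorted_w _.
(* The first letter creates the row [[:: a]]; the others are appended to it. *)
by rewrite [LHS](insert_word_row [:: a] [::]) // /dominated; case: (w).
Qed.

Lemma column_dominated (r r' : seq nat) (t : tableau) :
  size r' <= size r ->
  (forall j, j < size r -> sorted ltn (column [:: r, r' & t] j)) ->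
  dominated r r'.
Proof.
move=> le_r'r sorted_col; rewrite /dominated le_r'r.
apply/(all_nthP (0, 0)) => j; rewrite size_zip (minn_idPr le_r'r) => lt_jr'.
have lt_jr := leq_trans lt_jr' le_r'r.
rewrite nth_zip_cond size_zip (minn_idPr le_r'r) lt_jr' /=.
by have := sorted_col j lt_jr; rewrite /column /= lt_jr lt_jr' /= => /andP[].
Qed.

(** The bumped bottom row of [t] meets the same situation one row higher. At the top, a nonempty row
    is required, since inserting an empty one creates no row. *)
Lemma insert_word_bottom_row (r : seq nat) (t : tableau) :
  0 \notin shape (r :: t) -> all (sorted ltn) (r :: t) -> path dominated r t ->
  insert_word t r = r :: t.
Proof.
elim: t r => [|r' t IHt] r /=.
  rewrite mem_seq1 andbT => r_n0 sorted_r _.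
  by rewrite insert_word_nil // -size_eq0 eq_sym.
rewrite inE negb_or => /andP[r_n0 t_n0].
move=> /andP[sorted_r rows_t] /andP[dom_rr' dom_t].
by rewrite (insert_word_row [::]) // IHt.
Qed.

Lemma syt_dominated (t : tableau) : is_syt t -> sorted dominated t.
Proof.
case/and4P=> /andP[sh_t _] _ /allP cols_t _.
have {}cols_t j : j < size (head [::] t) -> sorted ltn (column t j).
  by move=> lt_j; apply: cols_t; rewrite mem_iota.
elim: t sh_t cols_t => [|r [|r' t] IHt] //= /andP[le_r'r sh_t] cols_t.
rewrite (column_dominated _ _ t) //=; apply: IHt => // j lt_j.
have lt_jr := leq_trans lt_j le_r'r.
(* Since [r] reaches past column [j], dropping [r] removes exactly the first entry of that
   column. *)
by have := cols_t j lt_jr; rewrite /column /= lt_jr => /path_sorted.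
Qed.

Lemma insert_reading_word (t : tableau) :
  is_syt t -> insert_word [::] (reading_word t) = t.
Proof.
move=> syt_t; have := syt_dominated _ syt_t.
case/and4P: syt_t => /andP[_ t_n0] rows_t _ _.
elim: t t_n0 rows_t => [|r t IHt] //= t_n0 rows_t dom_t.
rewrite /reading_word rev_cons flatten_rcons insert_word_cat -/(reading_word t).
rewrite IHt ?insert_word_bottom_row ?(path_sorted dom_t) //.
  by move: t_n0; rewrite inE negb_or => /andP[].
by case/andP: rows_t.
Qed.

Theorem lemma3p2 (S T S' T' : tableau) :
  is_syt S -> is_syt T -> shape S = shape T ->
  rsk (reading_word T) = (S', T') ->
  shape S' = shape S /\ shape T' = shape T.
Proof.
move=> _ syt_T -> rsk_T.
have uniq_T : uniq (reading_word T).
  have /and4P[_ _ _ perm_T] := syt_T.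
  have perm_rev : perm_eq (reading_word T) (flatten T).
    by apply: perm_flatten; rewrite perm_rev.
  by rewrite (perm_uniq perm_rev) (perm_uniq perm_T) iota_uniq.
have := shape_rsk _ uniq_T; have := rsk_insert_word (reading_word T).
by rewrite rsk_T insert_reading_word //= => -> ->.
Qed.
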